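(* For any positive integer $n$, the number $$\frac{1}{n^2} \sum_{k=0}^{n-1} (8k^2+12k+5)\, g_k(-1)$$ is an odd integer. Moreover, for any prime $p$ we have $$\sum_{k=0}^{p-1} (8k^2+12k+5)\, g_k(-1) \equiv 3p^2 \pmod{p^3}.$$
   Context: For $n=0,1,2,\ldots$, the polynomial $g_n(x)$ is defined by $g_n(x):=\sum_{k=0}^n\binom{n}{k}^2\binom{2k}{k}x^k$; thus $g_k(-1)=\sum_{l=0}^k\binom{k}{l}^2\binom{2l}{l}(-1)^l$. *)

(* Defs.v *)
From mathcomp Require Import all_boot all_order all_algebra.
Set Implicit Arguments.
Unset Strict Implicit.
Unset Printing Implicit Defensive.
Import Order.TTheory GRing.Theory Num.Theory.
Local Open Scope ring_scope.

Definition g (n : nat) : {poly int} :=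
  \sum_(0 <= k < n.+1) ('C(n, k) ^ 2 * 'C(2 * k, k))%N%:Z *: 'X^k.

(* Main.v *)
(** With [Cat_l] the Catalan numbers, the sum equals [n^2 a_n] where
    [a_n = \sum_l C(n-1,l)^2 (-1)^l Cat_l (2n + 3 + 5l)]: the [l]-th summand of
    [(n+1)^2 a_{n+1} - n^2 a_n - (8n^2+12n+5) g_n(-1)] is [T_{l+1} - T_l] with
    [T_l = l^2 C(n,l)^2 (-1)^l C(2l,l)].
    Since [(2n + 3 + 5l) Cat_l = 5 C(2l,l) + 2(n-1) Cat_l] is even for [l > 0],
    [a_n] is odd.  Modulo a prime [n = p] we have [C(p-1,l)^2 = 1], and
    [(5l + 3) (-1)^l Cat_l] is the difference of consecutive terms of
    [(-1)^l C(2l,l)], so [a_p] reduces to [1 - (-1)^p C(2p,p) = 3]. *)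
Require Import Defs.
From mathcomp Require Import all_boot all_order all_algebra.
From mathcomp Require Import zify ring.
Import Order.TTheory GRing.Theory Num.Theory.
Local Open Scope ring_scope.

Definition signed_central (l : nat) : int := (-1) ^+ l * 'C(2 * l, l)%:Z.

(** The difference of binomials is the Catalan number, written without division. *)
Definition signed_catalan (l : nat) : int :=
  (-1) ^+ l * ('C(2 * l, l)%:Z - 'C(2 * l, l.+1)%:Z).

Lemma bin_central_adjacent (l : nat) :
  (l%:Z + 1) * 'C(2 * l, l.+1)%:Z = l%:Z * 'C(2 * l, l)%:Z.
Proof.
have := mul_bin_left (2 * l) l.
by rewrite (_ : (2 * l - l)%N = l); lia.
Qed.

Lemma mul_succ_signed_catalan (l : nat) :
  (l%:Z + 1) * signed_catalan l = signed_central l.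
Proof.
by rewrite /signed_catalan mulrCA mulrBr bin_central_adjacent -mulrBl addrC addKr mul1r.
Qed.

Lemma signed_centralS (l : nat) :
  signed_central l.+1 = - (4 * l%:Z + 2) * signed_catalan l.
Proof.
have binE : 'C(2 * l.+1, l.+1) = (2 * ('C(2 * l, l) + 'C(2 * l, l.+1)))%N.
  rewrite (_ : 2 * l.+1 = (2 * l).+2)%N; last lia.
  (* Symmetry of the row [2 * l + 1] merges the two summands of Pascal's rule. *)
  rewrite binS [X in (_ + X)%N](_ : _ = 'C((2 * l).+1, l.+1)); first by rewrite binS; lia.
  by rewrite -bin_sub; [congr 'C(_, _) |]; lia.
have e := bin_central_adjacent l.
have {binE e} binE : 'C(2 * l.+1, l.+1)%:Z =
    (4 * l%:Z + 2) * ('C(2 * l, l)%:Z - 'C(2 * l, l.+1)%:Z).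
  by rewrite binE; lia.
by rewrite /signed_catalan /signed_central binE exprS; ring.
Qed.

Lemma horner_g_N1 (n : nat) :
  (g n).[-1] = \sum_(0 <= l < n.+1) 'C(n, l)%:Z ^+ 2 * signed_central l.
Proof.
rewrite /g horner_sum; apply: eq_bigr => l _.
by rewrite hornerZ hornerXn /signed_central PoszM expnS expn1 PoszM; ring.
Qed.

(** Shifted index: [sun_quotient n] is [a_{n+1}]. *)
Definition sun_quotient (n : nat) : int :=
  \sum_(0 <= l < n.+1)
    'C(n, l)%:Z ^+ 2 * signed_catalan l * (2 * n%:Z + 5 * l%:Z + 5).

Lemma sun_quotientS (n : nat) :
  (n%:Z + 2) ^+ 2 * sun_quotient n.+1 =
  (n%:Z + 1) ^+ 2 * sun_quotient n +
  (8 * n.+1%:Z ^+ 2 + 12 * n.+1%:Z + 5) * (g n.+1).[-1].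
Proof.
(* Both sums now use row [n.+1] and the same range; the extra term [l = n.+1] has a zero factor. *)
have widen : (n%:Z + 1) ^+ 2 * sun_quotient n =
    \sum_(0 <= l < n.+2) (n%:Z + 1 - l%:Z) ^+ 2 * 'C(n.+1, l)%:Z ^+ 2 *
      signed_catalan l * (2 * n%:Z + 5 * l%:Z + 5).
  rewrite big_nat_recr //= (_ : n%:Z + 1 - n.+1%:Z = 0); last lia.
  rewrite expr0n /= !mul0r addr0 mulr_sumr.
  apply: eq_big_nat => l /andP[_ lt_ln].
  have e : (n%:Z + 1) * 'C(n, l)%:Z = (n%:Z + 1 - l%:Z) * 'C(n.+1, l)%:Z.
    by have /= := mul_bin_down n.+1 l; nia.
  by rewrite -[X in _ = X * _ * _]exprMn -e; ring.
rewrite widen horner_g_N1 /sun_quotient !mulr_sumr -big_split /=.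
apply/eqP; rewrite -subr_eq0 -sumrB.
pose T (l : nat) := l%:Z ^+ 2 * 'C(n.+1, l)%:Z ^+ 2 * signed_central l.
rewrite (eq_big_nat _ _ (F2 := fun l => T l.+1 - T l)).
  (* [T 0] vanishes through [l ^ 2], and [T n.+2] through its binomial. *)
  by rewrite telescope_sumr // /T bin_small // expr0n !(mulr0, mul0r) subrr.
move=> l /andP[_ lt_ln].
have e : l.+1%:Z * 'C(n.+1, l.+1)%:Z = (n%:Z + 1 - l%:Z) * 'C(n.+1, l)%:Z.
  by have /= := mul_bin_left n.+1 l; nia.
rewrite /T -[l.+1%:Z ^+ 2 * _]exprMn e signed_centralS -mul_succ_signed_catalan.
by rewrite -[n.+1]addn1 PoszD; ring.
Qed.

Lemma sun_sumE (n : nat) :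
  \sum_(0 <= k < n.+1) (8 * k%:Z ^+ 2 + 12 * k%:Z + 5) * (g k).[-1] =
  (n%:Z + 1) ^+ 2 * sun_quotient n.
Proof.
elim: n => [|n IHn].
  by rewrite big_nat1 horner_g_N1 /sun_quotient !big_nat1.
rewrite big_nat_recr //= IHn -sun_quotientS.
by rewrite (_ : n.+1%:Z + 1 = n%:Z + 2) //; lia.
Qed.

Lemma signed_central_even (l : nat) : (2 %| signed_central l.+1)%Z.
Proof.
rewrite signed_centralS; apply/dvdzP.
by exists (- (2 * l%:Z + 1) * signed_catalan l); ring.
Qed.

Lemma sun_quotient_odd (n : nat) : (sun_quotient n = 1 %[mod 2])%Z.
Proof.
apply/eqP; rewrite eqz_mod_dvd /sun_quotient big_nat_recl //=.
rewrite bin0 -addrAC rpredD //.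
  apply/dvdzP; exists (n%:Z + 2).
  by rewrite /signed_catalan bin0 bin_small //; lia.
apply: rpred_sum => l _; rewrite -mulrA; apply: dvdz_mull.
have -> : signed_catalan l.+1 * (2 * n%:Z + 5 * l.+1%:Z + 5) =
    5 * signed_central l.+1 + n%:Z * signed_catalan l.+1 * 2.
  by rewrite -mul_succ_signed_catalan; ring.
by apply: rpredD; apply: dvdz_mull; rewrite ?signed_central_even.
Qed.

(** By Pascal's rule, neighbours in row [n] add up to an inner entry of row [n.+1], so they are
    opposite modulo the prime and their squares agree. *)
Lemma sqr_bin_pred_prime (n l : nat) : prime n.+1 -> (l <= n)%N ->
  (n.+1%:Z %| 'C(n, l)%:Z ^+ 2 - 1)%Z.
Proof.
move=> p_pr; elim: l => [|l IHl] le_ln; first by rewrite bin0 subrr dvdz0.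
have /dvdnP[q e] : (n.+1 %| 'C(n.+1, l.+1))%N by apply: prime_dvd_bin.
have -> : 'C(n, l.+1)%:Z ^+ 2 - 1 =
    'C(n, l)%:Z ^+ 2 - 1 + q%:Z * (q%:Z * n.+1%:Z - 2 * 'C(n, l)%:Z) * n.+1%:Z.
  have -> : 'C(n, l.+1)%:Z = q%:Z * n.+1%:Z - 'C(n, l)%:Z.
    by rewrite -PoszM -e binS PoszD addrK.
  by ring.
by apply: rpredD; [exact: IHl (ltnW le_ln) | exact: dvdz_mull].
Qed.

(** In Vandermonde's convolution only the two end terms, each 1, survive modulo [p]. *)
Lemma bin_double_prime (p : nat) : prime p -> 'C(2 * p, p) = 2 %[mod p].
Proof.
case: p => // n p_pr.
rewrite mul2n -addnn -(binomial.Vandermonde n.+1 n.+1 n.+1).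
rewrite big_ord_recl big_ord_recr /= !bin0 subn0 subnn binn bin0 !muln1 addnCA.
rewrite addnC -[2%N in RHS]addn0; apply/eqP; rewrite eqn_modDl mod0n.
by apply: dvdn_sum => i _; apply: dvdn_mulr; apply: prime_dvd_bin => //; exact: (ltn_ord i).
Qed.

Lemma signed_central_prime (p : nat) :
  prime p -> (p%:Z %| signed_central p + 2)%Z.
Proof.
move=> p_pr; have : (p%:Z %| 'C(2 * p, p)%:Z - 2)%Z.
  by rewrite -eqz_mod_dvd !modz_nat bin_double_prime.
rewrite /signed_central -signr_odd.
(* For [p = 2] the sign is positive, and 2 divides 6 + 2. *)
case: (even_prime p_pr) => [-> // | ->] /= dvd_bin.
by rewrite mulN1r addrC -opprB rpredN.
Qed.

Lemma sum_signed_catalan (n : nat) :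
  \sum_(0 <= l < n) signed_catalan l * (5 * l%:Z + 3) = 1 - signed_central n.
Proof.
rewrite -[1 in RHS]/(signed_central 0) -[RHS]opprB.
rewrite -(telescope_sumr signed_central (leq0n n)) -sumrN.
apply: eq_bigr => l _.
by rewrite signed_centralS -mul_succ_signed_catalan; ring.
Qed.

Lemma sun_quotient_prime (n : nat) : prime n.+1 ->
  (n.+1%:Z %| sun_quotient n - 3)%Z.
Proof.
move=> p_pr.
(* The 3 is 1 from the telescoped sum plus 2 from the central binomial. *)
have -> : sun_quotient n - 3 = - (signed_central n.+1 + 2) +
    \sum_(0 <= l < n.+1) ('C(n, l)%:Z ^+ 2 * signed_catalan l *
       (2 * n%:Z + 5 * l%:Z + 5) - signed_catalan l * (5 * l%:Z + 3)).
  by rewrite sumrB sum_signed_catalan -/(sun_quotient n); ring.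
apply: rpredD; first by rewrite rpredN signed_central_prime.
rewrite big_nat.
apply: rpred_sum => l /andP[_ lt_ln].
(* The weights [2n + 5l + 5] and [5l + 3] differ by twice the prime [n.+1]. *)
have -> : 'C(n, l)%:Z ^+ 2 * signed_catalan l * (2 * n%:Z + 5 * l%:Z + 5) -
      signed_catalan l * (5 * l%:Z + 3) =
    signed_catalan l * (2 * n%:Z + 5 * l%:Z + 5) * ('C(n, l)%:Z ^+ 2 - 1) +
    2 * signed_catalan l * n.+1%:Z.
  by rewrite -[n.+1]addn1 PoszD; ring.
by apply: rpredD; apply: dvdz_mull; rewrite ?sqr_bin_pred_prime.
Qed.

Theorem theorem1p2 :
  (forall n : nat, (0 < n)%N ->
     exists m : int,
       1 / (n%:R ^+ 2) *
         (\sum_(0 <= k < n)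
            (8 * k%:Z ^+ 2 + 12 * k%:Z + 5) * (g k).[-1])%:~R = m%:~R :> rat
       /\ (m = 1 %[mod 2])%Z)
  /\
  (forall p : nat, prime p ->
     (\sum_(0 <= k < p)
        (8 * k%:Z ^+ 2 + 12 * k%:Z + 5) * (g k).[-1]
      = 3 * p%:Z ^+ 2 %[mod p%:Z ^+ 3])%Z).
Proof.
split=> [[//|n] _|[//|n] p_pr].
  exists (sun_quotient n); split; last exact: sun_quotient_odd.
  rewrite sun_sumE [n%:Z + 1]addrC -intS rmorphM rmorphXn /= div1r mulKf //.
  by rewrite expf_neq0 // pnatr_eq0.
apply/eqP; rewrite eqz_mod_dvd sun_sumE [n%:Z + 1]addrC -intS.
(* Splitting off the square leaves a congruence modulo the prime itself. *)
rewrite [3 * _]mulrC -mulrBr [_ ^+ 3]exprSr.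
by apply: dvdz_mul => //; exact: sun_quotient_prime.
Qed.
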